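(* Let $A$ be a real constant and consider, for curves $x(s)$ in a four-dimensional pseudo-Riemannian space-time parametrized by the natural parameter $s$ (so $\frac{Dx}{ds}\cdot\frac{Dx}{ds}=1$), the equation $$\frac{D}{ds}\left[\Big(-3\,\frac{D^2x}{ds^2}\cdot\frac{D^2x}{ds^2}+A\Big)\frac{Dx_\alpha}{ds}-2\,\frac{D^3x_\alpha}{ds^3}\right]=-\pi^{(1)}{}_\nu\,R_{\alpha\beta\rho}{}^{\nu}\,\frac{Dx^\rho}{ds}\frac{Dx^\beta}{ds}.$$ In flat space-time, on the constraint manifold $k=k_0$ (where $k^2=\ddot x\cdot\ddot x$ and $k_0$ is a constant), this equation reduces, by putting $A=k_0^2+2\frac{m^2}{\sigma^2}$, to the Riewe--Costantelos equation $$\ddddot x+\left(k^2-\frac{m^2}{\sigma^2}\right)\ddot x=0,\qquad \dot x\cdot\dot x=1,$$ of the quasi-classical `Zitterbewegung' with the frequency $\omega=\sqrt{\tfrac32k_0^2-\tfrac A2}$ (that is, the equation has the form $\ddddot x+\omega^2\ddot x=0$).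
   Context: $\frac{D}{ds}$ denotes the covariant derivative along the curve ($\frac{Dx}{ds}=\frac{dx}{ds}$), $R_{\alpha\beta\rho}{}^{\nu}$ is the Riemann curvature tensor (zero in flat space-time), $\pi^{(1)}$ is a covector along the curve (a covariant momentum), the dot product is the metric scalar product, and dots over $x$ in the flat case denote derivatives with respect to $s$ in pseudo-Euclidean coordinates. $k$ is the first Frenet curvature, $k^2=\ddot x\cdot\ddot x$. The constant $m$ is a mass parameter, and $\sigma^2=\sigma\cdot\sigma\neq0$ with $$\sigma_\alpha=\frac{1}{2\|u\|}\,\epsilon_{\alpha\beta\rho\nu}u^\beta S^{\rho\nu},\qquad u=\dot x,\quad \|u\|=\sqrt{u\cdot u},$$ where $S^{\rho\nu}=-S^{\nu\rho}$ is the spin tensor of the particle along its world line and $\epsilon_{\alpha\beta\rho\nu}$ is the Levi-Civita tensor; $m^2/\sigma^2$ is constant along the curve. *)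

(* Defs.v *)
From HB Require Import structures.
From mathcomp Require Export all_boot all_order all_algebra perm.
From mathcomp Require Export all_classical all_reals all_analysis.
From mathcomp Require Export complex.

Set Implicit Arguments.
Unset Strict Implicit.
Unset Printing Implicit Defensive.

Import Order.TTheory GRing.Theory Num.Theory.
Import numFieldNormedType.Exports.

Local Open Scope ring_scope.
Local Open Scope classical_set_scope.

(* Everything is written in a coordinate chart, whose points, as well as the
   components of vectors and of covectors, are elements of ['rV[R]_4].
   A metric is a function [g] giving its covariant components [g y a b] at the
   point [y].  A curve is [x : R -> 'rV[R]_4], and a (co)vector field along it
   is a function of the same type. *)

Section Metric.
Variable R : realType.
Implicit Types (G : 'M[R]_4) (u v p q : 'rV[R]_4) (a b c d : 'I_4).

Definition dot G u v : R := \sum_a \sum_b G a b * u 0 a * v 0 b.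

Definition codot G p q : R := \sum_a \sum_b invmx G a b * p 0 a * q 0 b.

Definition lower G v : 'rV[R]_4 := \row_a \sum_b G a b * v 0 b.

(* Levi-Civita tensor: sqrt |det g| times the sign of the permutation
   (0,1,2,3) |-> (a,b,c,d); the sum is empty if two indices coincide. *)
Definition levi_civita G a b c d : R :=
  Num.sqrt `|\det G| *
  \sum_(t : 'S_4 | [forall i, t i == tnth [tuple a; b; c; d] i]) (-1) ^+ t.

Definition spin_vector G u (S : 'M[R]_4) : 'rV[R]_4 :=
  \row_a ((2 * Num.sqrt (dot G u u))^-1 *
          \sum_b \sum_c \sum_d levi_civita G a b c d * u 0 b * S c d).

Definition sigma2 G u (S : 'M[R]_4) : R :=
  codot G (spin_vector G u S) (spin_vector G u S).

End Metric.

Section Curvature.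
Variable R : realType.
Variable g : 'rV[R]_4 -> 'M[R]_4.
Implicit Types (a b c d e : 'I_4) (y : 'rV[R]_4).

Definition partial a (f : 'rV[R]_4 -> R) y : R := 'D_(delta_mx 0 a) f y.

(* Gamma^d_{ab} *)
Definition christoffel d a b y : R :=
  2^-1 * \sum_e invmx (g y) d e *
    (partial a (fun z => g z e b) y + partial b (fun z => g z e a) y
     - partial e (fun z => g z a b) y).

(* R_{abc}^d, with the sign fixed by
     (nabla_a nabla_b - nabla_b nabla_a) p_c = R_{abc}^d p_d;
   equivalently R(e_a,e_b)e_c = - R_{abc}^d e_d for
   R(X,Y) = [nabla_X, nabla_Y] - nabla_[X,Y].  This is the convention for
   which [world_line_eq] below is the Euler-Lagrange equation of the
   Lagrangian (k^2 + A) ||u||, with p_nu = 2 D^2 x_nu / ds^2. *)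
Definition riemann a b c d y : R :=
  partial b (christoffel d a c) y - partial a (christoffel d b c) y
  + \sum_e (christoffel e a c y * christoffel d b e y
            - christoffel e b c y * christoffel d a e y).

Variable x : R -> 'rV[R]_4.

(* D/ds of a vector field V^a, resp. a covector field P_a, along x *)
Definition cov_vec (V : R -> 'rV[R]_4) : R -> 'rV[R]_4 := fun s =>
  \row_a (derive1 V s 0 a + \sum_b \sum_c
            christoffel a b c (x s) * derive1 x s 0 b * V s 0 c).

Definition cov_covec (P : R -> 'rV[R]_4) : R -> 'rV[R]_4 := fun s =>
  \row_a (derive1 P s 0 a - \sum_b \sum_c
            christoffel c b a (x s) * derive1 x s 0 b * P s 0 c).

Definition D1 : R -> 'rV[R]_4 := derive1 x.
Definition D2 : R -> 'rV[R]_4 := cov_vec D1.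
Definition D3 : R -> 'rV[R]_4 := cov_vec D2.

Definition natural_parameter s : Prop := dot (g (x s)) (D1 s) (D1 s) = 1.

(* The covector inside the brackets of the equation. *)
Definition bracket (A : R) : R -> 'rV[R]_4 := fun s =>
  (- 3 * dot (g (x s)) (D2 s) (D2 s) + A) *: lower (g (x s)) (D1 s)
  - 2 *: lower (g (x s)) (D3 s).

Definition world_line_eq (A : R) (p : R -> 'rV[R]_4) s : Prop :=
  forall a, cov_covec (bracket A) s 0 a =
    - \sum_b \sum_c \sum_d
        p s 0 d * riemann a b c d (x s) * D1 s 0 c * D1 s 0 b.

End Curvature.

Section Flat.
Variable R : realType.
Implicit Types (U : set 'rV[R]_4) (g : 'rV[R]_4 -> 'M[R]_4) (eta : 'rV[R]_4).

(* The chart U consists of pseudo-Euclidean coordinates for g; the signature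
   is arbitrary. *)
Definition pseudo_euclidean_coordinates U g eta : Prop :=
  [/\ open U, forall a, eta 0 a = 1 \/ eta 0 a = -1
    & forall y, U y -> g y = diag_mx eta].

(* First Frenet curvature k, k^2 = x''.x''.  The scalar product being
   indefinite, x''.x'' may be negative (it always is, unless x'' = 0, in
   signature (+,-,-,-) with x'.x' = 1), so the root is taken in [R[i]]; it is
   the usual nonnegative root when x''.x'' >= 0. *)
Definition frenet_k2 eta (x : R -> 'rV[R]_4) s : R :=
  dot (diag_mx eta) (derive1n 2 x s) (derive1n 2 x s).
Definition frenet_k eta (x : R -> 'rV[R]_4) s : R[i] :=
  sqrtC (frenet_k2 eta x s)%:C%C.

Definition riewe_costantelos_eq eta (mu : R) (x : R -> 'rV[R]_4) s : Prop :=
  derive1n 4 x s + (frenet_k2 eta x s - mu) *: derive1n 2 x s = 0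
  /\ dot (diag_mx eta) (derive1 x s) (derive1 x s) = 1.

(* sqrt (3/2 k0^2 - A/2), real and nonnegative if the radicand is. *)
Definition zitterbewegung_frequency (A : R) (k0 : R[i]) : R[i] :=
  sqrtC (3 / 2 * k0 ^+ 2 - A%:C%C / 2).

(* x'''' + w^2 x'' = 0, w possibly imaginary *)
Definition oscillation_eq (w : R[i]) (x : R -> 'rV[R]_4) s : Prop :=
  forall a, (derive1n 4 x s 0 a)%:C%C + w ^+ 2 * (derive1n 2 x s 0 a)%:C%C = 0.

End Flat.

(* Main.v *)
(** In pseudo-Euclidean coordinates the connection and the curvature vanish, so
    covariant derivatives along the curve are ordinary ones.  Writing K for the
    constant [k0^2] and mu for [m^2 / sigma^2], the choice [A = K + 2 mu] turns
    the bracket into the lowering of [2 (mu - K) x' - 2 x'''], with constant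
    coefficients; its derivative is the lowering of [-2 (x'''' + (K - mu) x'')],
    and lowering an index is injective.  Finally [omega^2 = K - mu]. *)
Require Import Defs.
From mathcomp Require Import ring.

Set Implicit Arguments.
Unset Strict Implicit.

Import Order.TTheory GRing.Theory Num.Theory.
Import numFieldNormedType.Exports.

Local Open Scope ring_scope.
Local Open Scope classical_set_scope.

Section FlatConnection.
Variables (R : realType) (U : set 'rV[R]_4) (g : 'rV[R]_4 -> 'M[R]_4).
Variables (G : 'M[R]_4) (U_open : open U) (gU : forall y, U y -> g y = G).
Implicit Types (y : 'rV[R]_4) (a b c d : 'I_4).

(** A directional derivative depends only on the germ of [f] at [y], and the open set [U] is a
    neighbourhood of [y] on which that germ is constant. *)
Lemma partial_locally_constant a (f : 'rV[R]_4 -> R) (k : R) y :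
  U y -> (forall z, U z -> f z = k) -> partial a f y = 0.
Proof.
move=> Uy fk; rewrite /partial.
rewrite (near_eq_derive (g := cst k)) ?derive_cst//.
by near=> z; apply: fk; near: z; exact: open_nbhs_nbhs.
Unshelve. all: by end_near. Qed.

Lemma christoffel_flat d a b y : U y -> christoffel g d a b y = 0.
Proof.
move=> Uy; rewrite /christoffel big1 ?mulr0// => e _.
have dg i j k : partial i (fun z => g z j k) y = 0.
  by apply: (@partial_locally_constant _ _ (G j k)) => // z /gU ->.
by rewrite !dg addr0 subr0 mulr0.
Qed.

(** The quadratic terms need the Christoffel symbols to vanish only at [y]; the derivative terms
    vanish because the symbols are zero on all of [U]. *)
Lemma riemann_flat a b c d y : U y -> riemann g a b c d y = 0.
Proof.
move=> Uy; rewrite /riemann.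
have dC i j k l : partial i (christoffel g j k l) y = 0.
  by apply: (@partial_locally_constant _ _ 0) => // z; exact: christoffel_flat.
rewrite !dC subr0 add0r big1// => e _.
by rewrite !christoffel_flat// !mul0r subr0.
Qed.

Variable x : R -> 'rV[R]_4.

Lemma cov_vec_flat V s : U (x s) -> cov_vec g x V s = derive1 V s.
Proof.
move=> Us; apply/rowP => a; rewrite mxE big1 ?addr0// => b _.
by rewrite big1// => c _; rewrite christoffel_flat// !mul0r.
Qed.

Lemma cov_covec_flat P s : U (x s) -> cov_covec g x P s = derive1 P s.
Proof.
move=> Us; apply/rowP => a; rewrite mxE big1 ?subr0// => b _.
by rewrite big1// => c _; rewrite christoffel_flat// !mul0r.
Qed.

Variables (I : set R) (I_open : open I) (xU : forall s, I s -> U (x s)).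

(** Since [I] is open, identities valid on [I] can be differentiated; this is what allows flat
    formulas to be iterated from one derivative to the next. *)
Lemma derive1_eq_on (V : normedModType R) (f h : R -> V) s :
  (forall t, I t -> f t = h t) -> I s -> derive1 f s = derive1 h s.
Proof.
move=> fh Is; rewrite !derive1E; apply: near_eq_derive.
by near=> t; apply: fh; near: t; exact: open_nbhs_nbhs.
Unshelve. all: by end_near. Qed.

Lemma D2_flat s : I s -> D2 g x s = derive1n 2 x s.
Proof. by move=> Is; rewrite /D2 cov_vec_flat//; exact: xU. Qed.

Lemma D3_flat s : I s -> D3 g x s = derive1n 3 x s.
Proof.
move=> Is; rewrite /D3 cov_vec_flat; last exact: xU.
by apply: derive1_eq_on => // t; exact: D2_flat.
Qed.

Lemma world_line_eq_flat A p s : I s ->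
  world_line_eq g x A p s <-> derive1 (bracket g x A) s = 0.
Proof.
move=> Is; have Us := xU Is; rewrite /world_line_eq cov_covec_flat//.
have rhs0 a : - (\sum_b \sum_c \sum_d p s 0 d * riemann g a b c d (x s) *
    D1 x s 0 c * D1 x s 0 b) = 0.
  rewrite big1 ?oppr0// => b _; rewrite big1// => c _.
  by rewrite big1// => d _; rewrite riemann_flat// mulr0 !mul0r.
split=> [eq0 | -> a]; last by rewrite rhs0 mxE.
by apply/rowP => a; rewrite eq0 rhs0 mxE.
Qed.

End FlatConnection.

Lemma lower_diag_mx (R : realType) (eta v : 'rV[R]_4) a :
  lower (diag_mx eta) v 0 a = eta 0 a * v 0 a.
Proof.
rewrite mxE (bigD1 a)//= mxE eqxx mulr1n big1 ?addr0// => b ba.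
by rewrite mxE eq_sym (negbTE ba) mulr0n mul0r.
Qed.

Lemma derive1_coord (R : realType) n (F : R -> 'rV[R]_n) s i :
  derivable F s 1 -> derive1 F s 0 i = 'D_1 (fun t => F t 0 i) s.
Proof. by move=> dF; rewrite derive1E (derive_mx dF) mxE. Qed.

(** A diagonal metric lowers an index by rescaling each coordinate separately, so the claim splits
    into derivatives of scalar linear combinations with constant coefficients. *)
Lemma derive1_lower_lincomb (R : realType) (eta : 'rV[R]_4) (c d : R)
    (V W : R -> 'rV[R]_4) s a : derivable V s 1 -> derivable W s 1 ->
  derive1 (fun t => c *: lower (diag_mx eta) (V t) -
                    d *: lower (diag_mx eta) (W t)) s 0 a =
  eta 0 a * (c * derive1 V s 0 a - d * derive1 W s 0 a).
Proof.
move=> dV dW.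
have coordE i j : (fun t => (c *: lower (diag_mx eta) (V t) -
    d *: lower (diag_mx eta) (W t)) i j) =
    (eta 0 j * c) *: (fun t => V t 0 j) - (eta 0 j * d) *: (fun t => W t 0 j).
  apply/funext => t; rewrite (ord1 i) !fctE.
  have -> (u v : 'rV[R]_4) : (c *: u - d *: v) 0 j = c * u 0 j - d * v 0 j.
    by rewrite !mxE.
  by rewrite !lower_diag_mx /GRing.scale/=; ring.
have dVj j : derivable (fun t => V t 0 j) s 1
  by exact: ((derivable_mxP V s 1).1 dV 0 j).
have dWj j : derivable (fun t => W t 0 j) s 1
  by exact: ((derivable_mxP W s 1).1 dW 0 j).
have dVZ j := derivableZ (k := eta 0 j * c) (dVj j).
have dWZ j := derivableZ (k := eta 0 j * d) (dWj j).
rewrite derive1_coord; last first.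
  by apply/derivable_mxP => i j; rewrite coordE; exact: (derivableB (dVZ j) (dWZ j)).
rewrite coordE (deriveB (dVZ a) (dWZ a)).
rewrite (deriveZ _ (dVj a)) (deriveZ _ (dWj a)).
by rewrite (derive1_coord a dV) (derive1_coord a dW) /GRing.scale/=; ring.
Qed.

Theorem proposition3 (R : realType)
    (U : set 'rV[R]_4) (g : 'rV[R]_4 -> 'M[R]_4) (eta : 'rV[R]_4)
    (flat : pseudo_euclidean_coordinates U g eta)
    (I : set R) (I_open : open I) (I_itv : is_interval I)
    (x : R -> 'rV[R]_4) (xU : forall s, I s -> U (x s))
    (x_diff : forall (n : nat) (s : R), (n < 4)%N -> I s ->
       derivable (derive1n n x) s 1)
    (x_nat : forall s, I s -> natural_parameter g x s)
    (p : R -> 'rV[R]_4)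
    (m : R) (S : R -> 'M[R]_4)
    (S_skew : forall s, I s -> (S s)^T = - S s)
    (sigma_neq0 : forall s, I s -> sigma2 (g (x s)) (derive1 x s) (S s) != 0)
    (mu_const : forall s t, I s -> I t ->
       m ^+ 2 / sigma2 (g (x s)) (derive1 x s) (S s) =
       m ^+ 2 / sigma2 (g (x t)) (derive1 x t) (S t))
    (k0 : R[i]) (on_k0 : forall s, I s -> frenet_k eta x s = k0)
    (A : R)
    (A_def : forall s, I s ->
       A%:C%C = k0 ^+ 2 +
         2 * (m ^+ 2 / sigma2 (g (x s)) (derive1 x s) (S s))%:C%C) :
  let omega := zitterbewegung_frequency A k0 in
  forall s, I s ->
    let mu := m ^+ 2 / sigma2 (g (x s)) (derive1 x s) (S s) in
    [/\ world_line_eq g x A p s <-> riewe_costantelos_eq eta mu x s,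
        (frenet_k2 eta x s - mu)%:C%C = omega ^+ 2
      & riewe_costantelos_eq eta mu x s <->
          oscillation_eq omega x s /\
          dot (diag_mx eta) (derive1 x s) (derive1 x s) = 1].
Proof.
case: flat => U_open eta_unit gU omega s Is mu.
(* Squaring removes the choice of complex root, so the constancy of [k0] passes to the real function
   [frenet_k2] on [I]. *)
have k0E t : I t -> k0 ^+ 2 = (frenet_k2 eta x t)%:C%C.
  by move=> It; rewrite -(on_k0 t It) /frenet_k; exact: sqrtCK.
have k2_const t : I t -> frenet_k2 eta x t = frenet_k2 eta x s.
  by move=> It; exact: complexI (etrans (esym (k0E t It)) (k0E s Is)).
move: (k0E s Is) => {}k0E; set K := frenet_k2 eta x s in k2_const k0E *.
have AC : A%:C%C = K%:C%C + 2 * mu%:C%C by rewrite (A_def s Is) k0E.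
clearbody mu.
have AE : A = K + 2 * mu.
  by apply: complexI; rewrite AC rmorphD rmorphM rmorph_nat.
(* The radicand is 3/2 K - (K + 2 mu)/2 = K - mu, and squaring undoes [sqrtC] whatever its sign. *)
have omega2 : (K - mu)%:C%C = omega ^+ 2.
  by rewrite /omega /zitterbewegung_frequency sqrtCK k0E AC rmorphB; field.
(* The coefficient is -3 K + A = 2 (mu - K), with [K] and [mu] frozen at [s]. The identity is needed
   at every [t] in [I], because it is differentiated next. *)
have bracketE t : I t -> bracket g x A t =
    (2 * (mu - K)) *: lower (diag_mx eta) (derive1 x t)
    - 2 *: lower (diag_mx eta) (derive1n 3 x t).
  move=> It; rewrite /bracket gU; last exact: xU.
  rewrite (D3_flat U_open gU I_open xU It) (D2_flat U_open gU xU It).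
  rewrite -[dot _ _ _]/(frenet_k2 eta x t) k2_const// AE.
  by congr (_ *: _ - _); ring.
have natE : dot (diag_mx eta) (derive1 x s) (derive1 x s) = 1.
  by have := x_nat _ Is; rewrite /natural_parameter gU//; exact: xU.
split=> //.
- rewrite (world_line_eq_flat U_open gU xU A p Is).
  rewrite (derive1_eq_on I_open bracketE Is).
  set d4 := derive1n 4 x s; set d2 := derive1n 2 x s.
  have compE a : derive1 (fun t =>
      (2 * (mu - K)) *: lower (diag_mx eta) (derive1 x t)
      - 2 *: lower (diag_mx eta) (derive1n 3 x t)) s 0 a =
      - 2 * eta 0 a * (d4 + (K - mu) *: d2) 0 a.
    have := derive1_lower_lincomb eta (2 * (mu - K)) 2 a
      (x_diff 1%N s isT Is) (x_diff 3%N s isT Is).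
    (* Iterated derivatives unfold by conversion: differentiating x' and x''' gives [d2] and
       [d4]. *)
    rewrite -[derive1 (derive1n 1 x) s]/d2 -[derive1 (derive1n 3 x) s]/d4 => ->.
    by clearbody d2 d4; rewrite !mxE; ring.
  split=> [eq0 | [eq0 _]].
    split=> //; apply/rowP => a; rewrite [RHS]mxE.
    move/rowP/(_ a)/eqP: eq0; rewrite compE [X in _ == X]mxE !mulf_eq0.
    (* The factor -2 [eta 0 a] is nonzero, as [eta 0 a] is 1 or -1, so it can be cancelled in each
       component. *)
    have -> : (- 2 == 0 :> R) = false by rewrite oppr_eq0 pnatr_eq0.
    have /negbTE-> : eta 0 a != 0.
      by case: (eta_unit a) => ->; rewrite ?oppr_eq0 oner_eq0.
    by move=> /= /eqP.
  by apply/rowP => a; rewrite compE eq0 !mxE mulr0.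
- rewrite /riewe_costantelos_eq /oscillation_eq -omega2.
  (* As omega^2 is real, each complex oscillation equation is the image of a real one under the
     injective embedding of R into [R[i]]. *)
  have oscE a : (derive1n 4 x s 0 a)%:C%C +
      (K - mu)%:C%C * (derive1n 2 x s 0 a)%:C%C =
      ((derive1n 4 x s + (K - mu) *: derive1n 2 x s) 0 a)%:C%C.
    by rewrite !mxE [in RHS]rmorphD [in RHS]rmorphM.
  split=> -[eq0 _]; split=> //; first by move=> a; rewrite oscE eq0 mxE.
  by apply/rowP => a; apply: (@complexI R); rewrite -oscE eq0 mxE.
Qed.
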